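(* In the setting of the context and under the standing assumptions (A1) and (A2), let $$f^{\tau}_{\mathrm{MN}} := f^{\tau} -(\Lambda^{\tau})^+\left(\Lambda^{\tau}f^\tau+\partial^{\tau}_t\psi\right),\qquad (\Lambda^{\tau})^+=(\Lambda^{\tau})^\top\left(\Lambda^{\tau}(\Lambda^{\tau})^\top\right)^{-1},$$ where $(\Lambda^\tau)^+$ is the right Moore–Penrose pseudoinverse of $\Lambda^\tau$, and let $F^{\tau}_{\mathrm{MN}}:=D^{\tau}_tx-f^{\tau}_{\mathrm{MN}}$. Suppose that the discrete quantities satisfy the compatibility condition $$\Lambda^{\tau}D^{\tau}_tx= D^{\tau}_t\psi-\partial^{\tau}_t\psi$$ for all $(t^k,x^{k+1},\dots,x^{k-r+1})\in I\times U^{r+1}$ such that $$F^{\tau}_{\mathrm{MN}}(t^k,x^{k+1},\dots,x^{k-r+1})=0.$$ Then the $r$-step method defined by $F^{\tau}_{\mathrm{MN}}(t^k,x^{k+1},\dots,x^{k-r+1})=0$ is conservative in $\psi^{\tau}$. Moreover, it is consistent of at least order $q$ to the function $F(t,x,\dot x)=\dot x-f(t,x)$, and for any $x\in C^{p+q}(I\to U)$ the discrete quantities satisfy $$\Lambda^{\tau}D^{\tau}_tx - D^{\tau}_t\psi + \partial^{\tau}_t\psi = \mathcal{O}(\tau^q),\qquad \Lambda^{\tau}f_{\mathrm{MN}}^{\tau} + \partial^{\tau}_t \psi = \mathcal{O}(\tau^q).$$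
   Context: Continuous setting. $m,n,p,q,r\ge 1$ are integers, $I\subset\mathbb{R}$ is an open time interval (a maximal interval of existence), $U, U^{(1)},U^{(2)},\dots\subset\mathbb{R}^n$ are open, and $U^{r+1}$ is the Cartesian product of $r+1$ copies of $U$. The source $f\in C^{p-1}(I\times U\to\mathbb{R}^n)$ is Lipschitz continuous in $U$, and the dynamical system is $F(t,x(t),\dot x(t)):=\dot{x}(t)-f(t,x(t))=0$, $x(t^0)=x^0$. A function $\psi\in C^1(I\times U\to\mathbb{R}^m)$ is a conserved quantity of $F$ if the total time derivative $D_t\psi(t,x(t))$ vanishes for all solutions $x$. A matrix-valued continuous function $\Lambda:I\times U\to M_{m\times n}(\mathbb{R})$ is a conservation law multiplier of $F$ associated with $\psi$ if $\Lambda(t,x(t))F(t,x(t),\dot x(t))=D_t\psi(t,x(t))$ for all (arbitrary) $x\in C^1(I\to U)$. Discrete setting. $t^0<t^1<\dots$ is a sequence in $I$ with $\tau=\sup_k(t^{k+1}-t^k)<\infty$. Let $W$ be a finite dimensional normed vector space (matrix spaces carry the operator norm). An $r$-step function $g^\tau\in C^{p+q}(I\times U^{r+1}\to W)$ is consistent of order $q$ to a function $g\in C^{p+q}(I\times U\times U^{(1)}\times\dots\times U^{(p)}\to W)$ if for any $x\in C^{p+q}(I\to U)$ there exists a constant $C(g,x)>0$ independent of $\tau$ such that $$\|g(t^k,x(t^k),\dots,x^{(p)}(t^k))-g^{\tau}(t^k,x(t^{k+1}),\dots,x(t^{k-r+1}))\|_W\le C(g,x)\,\tau^q;$$ one then writes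 $g^\tau=g+\mathcal{O}(\tau^q)$. For discrete expressions evaluated along a curve $x$ in this way, ''$=\mathcal{O}(\tau^q)$'' means this estimate with $g=0$. An $r$-step method $F^\tau$ is conservative in an $(r-1)$-step function $\psi^\tau$ if $$\psi^\tau(t^k,x^{k},\dots,x^{k-r+1})=\psi^\tau(t^{k+1},x^{k+1},\dots,x^{k-r+2})$$ whenever $x^{k+1}$ satisfies $F^{\tau}(t^k,x^{k+1},\dots,x^{k-r+1})=0$. An $r$-step function $D_t^\tau\psi$ consistent to $D_t\psi$ is constant compatible with $\psi^\tau$ if $D_t^\tau\psi(t^k,x^{k+1},\dots,x^{k-r+1})=0$ implies the same equality of $\psi^\tau$ values. Standing assumptions. (A1) $m<n$ and $\Lambda(t,x)$ has full row rank within $I\times U$. (A2) $f^{\tau}$, $D^{\tau}_tx$, $D^{\tau}_t\psi$, $\partial^{\tau}_t\psi$ and $\Lambda^{\tau}$ are $r$-step functions consistent of order $q$ respectively to $f$, $\dot{x}$, $D_t\psi$, $\partial_t\psi$ and $\Lambda$, where $\Lambda$ is a conservation law multiplier of $F$ associated with the conserved quantity $\psi$; and $D^{\tau}_{t}\psi$ is constant compatible with a discrete $(r-1)$-step function $\psi^\tau$ (consistent to $\psi$).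
   Formalization: The estimate with C(g,x) independent of τ is read, in assumptions and conclusions alike, as: for each compact part K of I there are C and τ₀>0 with the bound for all τ≤τ₀ and all t^k in K; invertibility of Λ^τ(Λ^τ)^⊤ on I×U^{r+1} is assumed. *)

(* Defs.v *)
From HB Require Import structures.
From mathcomp Require Import all_boot all_order all_algebra.
From mathcomp Require Import all_classical all_reals all_analysis.
Import Order.TTheory GRing.Theory Num.Theory.
Import numFieldNormedType.Exports.

Set Implicit Arguments.
Unset Strict Implicit.
Unset Printing Implicit Defensive.

Local Open Scope ring_scope.
Local Open Scope classical_set_scope.

(** [Ck s A g]: g is of class C^s at the points of the open set A; in finite
    dimension, g is C^(s+1) iff it is Fréchet differentiable and all its
    directional derivatives are C^s. *)
Fixpoint Ck (R : realType) (E W : normedModType R) (s : nat) (A : set E)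
    (g : E -> W) : Prop :=
  match s with
  | 0 => forall z, A z -> {for z, continuous g}
  | s'.+1 => (forall z, A z -> differentiable g z) /\
             (forall v, Ck s' A (fun z => 'd g z v))
  end.

(** The library norm of a matrix is the maximum of the moduli of its entries;
    it only provides the topology. Estimates use the Euclidean norm of column
    vectors and the operator norm that it induces on matrices. *)
Definition enorm (R : realType) (n : nat) (v : 'cV[R]_n) : R :=
  Num.sqrt (\sum_i v i 0 ^+ 2).

Definition opnorm (R : realType) (m n : nat) (A : 'M[R]_(m, n)) : R :=
  sup [set enorm (A *m v) | v in [set v : 'cV[R]_n | enorm v <= 1]].

Definition C1curve (R : realType) (n : nat) (I : set R) (U : set 'cV[R]_n)
    (x : R -> 'cV[R]_n) : Prop :=
  Ck 1 I x /\ (forall s, I s -> U (x s)).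

Definition is_solution (R : realType) (n : nat) (I : set R) (U : set 'cV[R]_n)
    (f : R * 'cV[R]_n -> 'cV[R]_n) (x : R -> 'cV[R]_n) : Prop :=
  C1curve I U x /\ (forall s, I s -> derive1 x s - f (s, x s) = 0).

Definition conserved_quantity (R : realType) (n m : nat) (I : set R)
    (U : set 'cV[R]_n) (f : R * 'cV[R]_n -> 'cV[R]_n)
    (psi : R * 'cV[R]_n -> 'cV[R]_m) : Prop :=
  Ck 1 (I `*` U) psi /\
  forall x, is_solution I U f x ->
    forall s, I s -> derive1 (fun u => psi (u, x u)) s = 0.

Definition multiplier (R : realType) (n m : nat) (I : set R)
    (U : set 'cV[R]_n) (f : R * 'cV[R]_n -> 'cV[R]_n)
    (psi : R * 'cV[R]_n -> 'cV[R]_m)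
    (Lambda : R * 'cV[R]_n -> 'M[R]_(m, n)) : Prop :=
  (forall z, (I `*` U) z -> {for z, continuous Lambda}) /\
  forall x, C1curve I U x -> forall s, I s ->
    Lambda (s, x s) *m (derive1 x s - f (s, x s)) =
    derive1 (fun u => psi (u, x u)) s.

(** A function of (t, x, x', ..., x^(p)) is a function on R * 'M_(n, p.+1):
    column j of the matrix holds the j-th derivative. [V j] is the open set
    written U^(j) (only 1 <= j <= p matter). *)
Definition jet (R : realType) (n p : nat) (x : R -> 'cV[R]_n) (s : R) :
    'M[R]_(n, p.+1) :=
  \matrix_(i, j) derive1n j x s i 0.

Definition jet_domain (R : realType) (n p : nat) (I : set R)
    (U : set 'cV[R]_n) (V : nat -> set 'cV[R]_n) :
    set (R * 'M[R]_(n, p.+1)) :=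
  [set z | [/\ I z.1, U (col ord0 z.2) &
               forall j : 'I_p.+1, (0 < j)%N -> V j (col j z.2)]].

(** C^s curves in U along which functions on the jet domain can be evaluated *)
Definition curve (R : realType) (n p s : nat) (I : set R) (U : set 'cV[R]_n)
    (V : nat -> set 'cV[R]_n) (x : R -> 'cV[R]_n) : Prop :=
  Ck s I x /\ forall u, I u -> jet_domain I U V (u, jet p x u).

Section JetFunctions.
Variables (R : realType) (n p : nat).
Implicit Type z : R * 'M[R]_(n, p.+1).

Definition of_state (W : Type) (g : R * 'cV[R]_n -> W) z : W :=
  g (z.1, col ord0 z.2).

Definition xdot z : 'cV[R]_n := col (inord 1) z.2.

Definition ode (f : R * 'cV[R]_n -> 'cV[R]_n) z : 'cV[R]_n :=
  xdot z - of_state f z.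

Definition partial_t (m : nat) (psi : R * 'cV[R]_n -> 'cV[R]_m) z : 'cV[R]_m :=
  'd psi (z.1, col ord0 z.2) (1, 0).

(** psi_t + psi_x x' *)
Definition total_t (m : nat) (psi : R * 'cV[R]_n -> 'cV[R]_m) z : 'cV[R]_m :=
  'd psi (z.1, col ord0 z.2) (1, xdot z).

End JetFunctions.

Definition steps (R : realType) (t : nat -> R) : set R :=
  [set t k.+1 - t k | k in [set: nat]].

Definition mesh (R : realType) (t : nat -> R) : R := sup (steps t).

Definition time_grid (R : realType) (I : set R) (t0 : R) (t : nat -> R) : Prop :=
  [/\ t 0%N = t0, forall k, t k < t k.+1, forall k, I (t k) &
      has_ubound (steps t)].

(** A discrete function of time and c states. Being built from the time steps,
    it is a family indexed by the grid. For an r-step function c = r.+1, and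
    column j of the matrix is x^{k+1-j}. *)
Definition discrete (R : realType) (n c : nat) (W : Type) : Type :=
  (nat -> R) -> R * 'M[R]_(n, c) -> W.

Definition stencil_domain (R : realType) (n c : nat) (I : set R)
    (U : set 'cV[R]_n) : set (R * 'M[R]_(n, c)) :=
  [set z | I z.1 /\ forall j, U (col j z.2)].

(** the states x(t^{k+1}), ..., x(t^{k-r+1}); only used for r <= k+1, where
    the natural subtraction does not truncate *)
Definition stencil (R : realType) (n r : nat) (x : R -> 'cV[R]_n)
    (t : nat -> R) (k : nat) : 'M[R]_(n, r.+1) :=
  \matrix_(i, j) x (t (k.+1 - j)%N) i 0.

(** e = O(tau^q) as tau = mesh t -> 0, over the grids t of T, with a constant
    that depends neither on the grid nor on k as long as t^k stays in a compact
    part of I. On the whole open interval I no such constant exists even for the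
    standard difference quotients, since x' is unbounded in general. [N] is the
    norm of W. *)
Definition bigO_mesh (R : realType) (W : Type) (r q : nat) (I : set R)
    (T : set (nat -> R)) (N : W -> R) (e : (nat -> R) -> nat -> W) : Prop :=
  forall K : set R, compact K -> K `<=` I ->
  exists C : R, exists tau0 : R, [/\ 0 < C, 0 < tau0 &
    forall t, T t -> mesh t <= tau0 ->
    forall k, (r <= k.+1)%N -> K (t k) -> N (e t k) <= C * mesh t ^+ q].

Definition consistent (R : realType) (W : normedModType R) (n p q r s : nat)
    (I : set R) (U : set 'cV[R]_n) (V : nat -> set 'cV[R]_n)
    (T : set (nat -> R)) (N : W -> R)
    (g : R * 'M[R]_(n, p.+1) -> W) (gtau : discrete R n r.+1 W) : Prop :=
  [/\ Ck s (@jet_domain R n p I U V) g,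
      forall t, T t -> Ck s (stencil_domain I U) (gtau t) &
      forall x, curve p s I U V x ->
        bigO_mesh r q I T N
          (fun t k => g (t k, jet p x (t k)) - gtau t (t k, stencil r x t k))].

(** With column j of X equal to x^{k+1-j}, [col' ord0 X] lists x^k, ...,
    x^{k-r+1} and [col' ord_max X] lists x^{k+1}, ..., x^{k-r+2}. *)
Definition conservative (R : realType) (n m r : nat) (U : set 'cV[R]_n)
    (T : set (nat -> R)) (Ftau : discrete R n r.+1 'cV[R]_n)
    (psitau : discrete R n r 'cV[R]_m) : Prop :=
  forall t k (X : 'M[R]_(n, r.+1)), T t -> (r <= k.+1)%N ->
    (forall j, U (col j X)) ->
    Ftau t (t k, X) = 0 ->
    psitau t (t k, col' ord0 X) = psitau t (t k.+1, col' ord_max X).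

Definition constant_compatible (R : realType) (n m r : nat) (U : set 'cV[R]_n)
    (T : set (nat -> R)) (Dpsi : discrete R n r.+1 'cV[R]_m)
    (psitau : discrete R n r 'cV[R]_m) : Prop :=
  forall t k (X : 'M[R]_(n, r.+1)), T t -> (r <= k.+1)%N ->
    (forall j, U (col j X)) ->
    Dpsi t (t k, X) = 0 ->
    psitau t (t k, col' ord0 X) = psitau t (t k.+1, col' ord_max X).

(** (r-1)-step functions as r-step functions that ignore x^{k+1} *)
Definition delay (R : realType) (n r : nat) (W : Type)
    (g : discrete R n r W) : discrete R n r.+1 W :=
  fun t z => g t (z.1, col' ord0 z.2).

(** right Moore-Penrose pseudoinverse of a matrix of full row rank *)
Definition right_pinv (R : realType) (m n : nat) (A : 'M[R]_(m, n)) :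
    'M[R]_(n, m) :=
  A^T *m invmx (A *m A^T).

Definition f_MN (R : realType) (n m c : nat) (ftau : discrete R n c 'cV[R]_n)
    (Lambdatau : discrete R n c 'M[R]_(m, n))
    (dpsi : discrete R n c 'cV[R]_m) : discrete R n c 'cV[R]_n :=
  fun t z => ftau t z -
    right_pinv (Lambdatau t z) *m (Lambdatau t z *m ftau t z + dpsi t z).

Definition F_MN (R : realType) (n m c : nat) (Dx : discrete R n c 'cV[R]_n)
    (ftau : discrete R n c 'cV[R]_n)
    (Lambdatau : discrete R n c 'M[R]_(m, n))
    (dpsi : discrete R n c 'cV[R]_m) : discrete R n c 'cV[R]_n :=
  fun t z => Dx t z - f_MN ftau Lambdatau dpsi t z.

(* Main.v *)
(** The pseudoinverse correction makes Lambda^tau f_MN + psi_t^tau vanish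
    identically, so on F_MN = 0 the compatibility condition forces
    D_t^tau psi = 0, hence the conservation of psi^tau.

    For the orders, the multiplier identity tested on a constant curve gives
    Lambda f = - psi_t, and then on a curve x it gives
    Lambda x' = D_t psi - psi_t. The residuals of the discrete versions of these
    two identities are O(tau^q) by a product rule for discretization errors.
    The MN correction is the residual of the first one multiplied by
    (Lambda^tau)^+, which stays bounded for small tau: M |-> M^+ is continuous
    at matrices of full row rank, Lambda^tau converges uniformly, and Lambda
    takes its values along x in a compact set of such matrices. *)
Require Import Defs.
From HB Require Import structures.
From mathcomp Require Import all_boot all_order all_algebra.
From mathcomp Require Import all_classical all_reals all_analysis.
Import Order.TTheory GRing.Theory Num.Theory.
Import numFieldNormedType.Exports.

Set Implicit Arguments.
Unset Strict Implicit.
Unset Printing Implicit Defensive.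

Local Open Scope ring_scope.
Local Open Scope classical_set_scope.

(* The difference g - f vanishes near x, so its differential there is 0. *)
Lemma near_eq_is_diff (R : numFieldType) (V W : normedModType R)
    (f g df : V -> W) (x : V) :
  {near x, f =1 g} -> is_diff x f df -> is_diff x g df.
Proof.
move=> fg dfx.
have h0 : (g - f) x = 0.
  by rewrite /GRing.add /GRing.opp /= (nbhs_singleton fg) subrr.
have o0 : (g - f) \o shift x = cst ((g - f) x) + (0 : V -> W) +o_ 0 id.
  apply/eqaddoP => _ /posnumP[e].
  have : \forall y \near (0 : V), f (y + x) = g (y + x).
    rewrite (near_shift x) sub0r; near=> y.
    rewrite /= subrK; near: y; exact: fg.
  apply: filterS => y fgy.
  rewrite h0 !fctE /= fgy subrr addr0 subrr normr0.
  by rewrite mulr_ge0.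
have d0 : 'd (g - f) x = (0 : V -> W) :> (V -> W).
  by apply: (diff_unique (df := \0)) => //; exact: cst_continuous.
have dh : is_diff x (g - f) (0 : V -> W).
  apply: DiffDef => //; apply/diff_locallyP; rewrite d0; split => //.
  exact: cst_continuous.
have -> : g = f + (g - f) by rewrite addrC subrK.
exact: is_diff_eq (is_diffD dfx dh) (addr0 _).
Unshelve. all: by end_near. Qed.

(** * Calculus of C^k maps on an open set *)

Section CkTheory.
Variables (R : realType) (E : normedModType R) (A : set E).
Hypothesis A_open : open A.

(** [A] is open, so agreement on [A] is agreement near each of its points. The differentials then
    agree on [A] as well, and induction applies to them. *)
Lemma Ck_ext (W : normedModType R) s (f g : E -> W) :
  (forall z, A z -> f z = g z) -> Ck s A f -> Ck s A g.
Proof.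
elim: s f g => [|s IH] f g fg.
  move=> fc z Az; have fgz : {near z, f =1 g}.
    by near=> y; apply: fg; near: y; exact: open_nbhs_nbhs.
  rewrite /prop_for /continuous_at -(fg _ Az).
  exact: (cvg_trans (near_eq_cvg fgz) (fc z Az)).
have fgd z : A z -> differentiable f z -> is_diff z g ('d f z).
  move=> Az fz; apply: (@near_eq_is_diff _ _ _ f); last exact: differentiableP.
  by near=> y; apply: fg; near: y; exact: open_nbhs_nbhs.
move=> [fdiff fC]; split=> [z Az|v].
  by have [] := fgd z Az (fdiff z Az).
apply: IH (fC v) => z Az.
exact/esym/(congr1 (@^~ v))/(diff_val (is_diff_def:=fgd z Az (fdiff z Az))).
Unshelve. all: by end_near. Qed.

Lemma Ck_pred (W : normedModType R) s (f : E -> W) : Ck s.+1 A f -> Ck s A f.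
Proof.
elim: s f => [|s IH] f [df fC].
  by move=> z Az; exact/differentiable_continuous/df.
by split=> // v; exact/IH/fC.
Qed.

Lemma Ck_le (W : normedModType R) s s' (f : E -> W) :
  (s <= s')%N -> Ck s' A f -> Ck s A f.
Proof.
move=> /subnK <-; elim: (s' - s)%N => // k IH.
by rewrite addSn => /Ck_pred.
Qed.

(** Trades ['d f] for a derivative formula valid on [A] only. The inductions on the order in the
    differentiation rules below go through it. *)
Lemma Ck_is_diff (W : normedModType R) s (f : E -> W) (df : E -> E -> W) :
  (forall z, A z -> is_diff z f (df z)) -> (forall v, Ck s A (df ^~ v)) ->
  Ck s.+1 A f.
Proof.
move=> fd dfC; split=> [z Az|v]; first by have [] := fd z Az.
apply: Ck_ext (dfC v) => z Az.
exact/esym/(congr1 (@^~ v))/(diff_val (is_diff_def:=fd z Az)).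
Qed.

Lemma Ck_cst (W : normedModType R) s (a : W) : Ck s A (fun=> a).
Proof.
elim: s a => [|s IH] a; first by move=> z Az; exact: cst_continuous.
by apply: (@Ck_is_diff _ _ _ (fun _ _ => 0)).
Qed.

Lemma Ck_linear (V W : normedModType R) s (L : {linear V -> W}) (f : E -> V) :
  continuous L -> Ck s A f -> Ck s A (L \o f).
Proof.
move=> Lc; elim: s f => [|s IH] f.
  by move=> fc z Az; apply: continuous_comp; [exact: fc|exact: Lc].
move=> [df fC]; apply: (@Ck_is_diff _ _ _ (fun z v => L ('d f z v))) => [z Az|v].
  have Ld : is_diff (f z) L L.
    by apply: DiffDef; [exact: linear_differentiable|exact: diff_lin].
  have fd := differentiableP (df z Az).
  exact: is_diff_comp.
exact: (IH _ (fC v)).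
Qed.

Lemma CkD (W : normedModType R) s (f g : E -> W) :
  Ck s A f -> Ck s A g -> Ck s A (fun z => f z + g z).
Proof.
elim: s f g => [|s IH] f g.
  by move=> fc gc z Az; apply: continuousD; [exact: fc|exact: gc].
move=> [df fC] [dg gC].
apply: (@Ck_is_diff _ _ _ (fun z v => 'd f z v + 'd g z v)) => [z Az|v].
  have fd := differentiableP (df z Az).
  have gd := differentiableP (dg z Az).
  exact: is_diffD.
exact: IH (fC v) (gC v).
Qed.

Lemma CkN (W : normedModType R) s (f : E -> W) :
  Ck s A f -> Ck s A (fun z => - f z).
Proof.
elim: s f => [|s IH] f.
  by move=> fc z Az; apply: continuousN; exact: fc.
move=> [df fC].
apply: (@Ck_is_diff _ _ _ (fun z v => - 'd f z v)) => [z Az|v].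
  have fd := differentiableP (df z Az).
  exact: is_diffN.
exact: IH (fC v).
Qed.

Lemma CkB (W : normedModType R) s (f g : E -> W) :
  Ck s A f -> Ck s A g -> Ck s A (fun z => f z - g z).
Proof. by move=> fC gC; apply: CkD => //; exact: CkN. Qed.

Lemma Ck_sum (W : normedModType R) s (I : Type) (r : seq I) (P : pred I)
    (f : I -> E -> W) :
  (forall i, Ck s A (f i)) -> Ck s A (fun z => \sum_(i <- r | P i) f i z).
Proof.
move=> fC; elim: r => [|i r IH].
  by under eq_fun do rewrite big_nil; exact: Ck_cst.
under eq_fun do rewrite big_cons.
by case: (P i) => //; exact: CkD.
Qed.

Lemma CkM s (f g : E -> R) :
  Ck s A f -> Ck s A g -> Ck s A (fun z => f z * g z).
Proof.
elim: s f g => [|s IH] f g.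
  by move=> fc gc z Az; apply: continuousM; [exact: fc|exact: gc].
(* The product rule keeps one factor undifferentiated, so the lower order facts about [f] and [g]
   are saved for the induction hypothesis. *)
move=> fC1 gC1; have [fC0 gC0] := (Ck_pred fC1, Ck_pred gC1).
move: fC1 gC1 => [df fC] [dg gC].
apply: (@Ck_is_diff _ _ _ (fun z v => f z * 'd g z v + g z * 'd f z v)) => [z Az|v].
  have fd := differentiableP (df z Az).
  have gd := differentiableP (dg z Az).
  by apply: (is_diff_eq (is_diffM fd gd)); apply/funext => v.
apply: CkD; [exact: (IH _ _ fC0 (gC v))|exact: (IH _ _ gC0 (fC v))].
Qed.

Lemma CkZl (W : normedModType R) s (f : E -> R) (w : W) :
  Ck s A f -> Ck s A (fun z => f z *: w).
Proof.
elim: s f => [|s IH] f.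
  move=> fc z Az.
  by apply: (@continuous_comp _ _ _ f ( *:%R^~ w));
    [exact: fc|exact: scalel_continuous].
move=> [df fC].
apply: (@Ck_is_diff _ _ _ (fun z v => 'd f z v *: w)) => [z Az|v].
  by apply: DiffDef; [exact/differentiableZl/df|exact/diffZl/df].
exact: IH (fC v).
Qed.

Lemma Ck_prod s (I : Type) (r : seq I) (P : pred I) (f : I -> E -> R) :
  (forall i, Ck s A (f i)) -> Ck s A (fun z => \prod_(i <- r | P i) f i z).
Proof.
move=> fC; elim: r => [|i r IH].
  by under eq_fun do rewrite big_nil; exact: Ck_cst.
under eq_fun do rewrite big_cons.
case: (P i) => //.
exact: (CkM (fC i) IH).
Qed.

(** The derivative [- f^-2 f'] contains the inverse itself, which has the order required by the
    induction hypothesis. *)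
Lemma CkV s (f : E -> R) :
  (forall z, A z -> f z != 0) -> Ck s A f -> Ck s A (fun z => (f z)^-1).
Proof.
move=> f0; elim: s => [|s IH].
  by move=> fc z Az; apply: continuousV; [exact: f0|exact: fc].
move=> fC1; have fC0 := Ck_pred fC1; move: fC1 => [df fC].
apply: (@Ck_is_diff _ _ _ (fun z v => - ((f z)^-1 * (f z)^-1 * 'd f z v)))
  => [z Az|v].
  apply: DiffDef; first by apply: differentiableV; [exact: df|exact: f0].
  rewrite diffV ?f0//; last exact: df.
  by apply/funext => v; rewrite -expr2 exprVn -scaleNr.
have VC := IH fC0; exact: (CkN (CkM (CkM VC VC) (fC v))).
Qed.

Lemma Ck_entry m n s (M : E -> 'M[R]_(m, n)) i j :
  Ck s A M -> Ck s A (fun z => M z i j).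
Proof.
move=> MC.
have cl : linear (fun N : 'M[R]_(m, n) => N i j : R).
  by move=> a u v; rewrite !mxE.
pose cL := GRing.isLinear.Build _ _ _ _ _ cl.
pose c : {linear _ -> _} := HB.pack (fun N : 'M[R]_(m, n) => N i j : R) cL.
apply: (Ck_linear (L := c)) MC; exact: coord_continuous.
Qed.

(** In the basis [delta_mx i j] the map is a sum of scalar functions times constant matrices. *)
Lemma Ck_mx m n s (M : E -> 'M[R]_(m, n)) :
  (forall i j, Ck s A (fun z => M z i j)) -> Ck s A M.
Proof.
move=> MC.
apply: (@Ck_ext _ _ (fun z => \sum_i \sum_j M z i j *: delta_mx i j)).
  by move=> z _; rewrite -matrix_sum_delta.
by apply: Ck_sum => i; apply: Ck_sum => j; exact: CkZl.
Qed.

Lemma Ck_mulmx m n k s (M : E -> 'M[R]_(m, n)) (N : E -> 'M[R]_(n, k)) :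
  Ck s A M -> Ck s A N -> Ck s A (fun z => M z *m N z).
Proof.
move=> MC NC; apply: Ck_mx => i j.
under eq_fun do rewrite mxE.
by apply: Ck_sum => l; apply: CkM; exact: Ck_entry.
Qed.

Lemma Ck_trmx m n s (M : E -> 'M[R]_(m, n)) :
  Ck s A M -> Ck s A (fun z => (M z)^T).
Proof.
move=> MC; apply: Ck_mx => i j; under eq_fun do rewrite mxE; exact: Ck_entry.
Qed.

Lemma Ck_det n s (M : E -> 'M[R]_n) :
  (forall i j, Ck s A (fun z => M z i j)) -> Ck s A (fun z => \det (M z)).
Proof.
(* [\det] unfolds to the Leibniz sum of signed products of entries. *)
move=> MC; apply: Ck_sum => i; apply: CkM; first exact: Ck_cst.
exact: Ck_prod.
Qed.

(** Cramer's rule: entries of the adjugate are signed minors, and the determinant does not vanish on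
    [A]. *)
Lemma Ck_invmx n s (M : E -> 'M[R]_n) :
  (forall z, A z -> M z \in unitmx) -> Ck s A M ->
  Ck s A (fun z => invmx (M z)).
Proof.
move=> Mu MC.
apply: (@Ck_ext _ _ (fun z => (\det (M z))^-1 *: \adj (M z))).
  by move=> z Az; rewrite /invmx Mu.
apply: Ck_mx => i j; under eq_fun do rewrite !mxE; apply: CkM.
  apply: CkV => [z /Mu|]; first by rewrite unitmxE unitfE.
  by apply: Ck_det => i' j'; exact: Ck_entry.
apply: CkM; first exact: Ck_cst.
apply: Ck_det => i' j'; under eq_fun do rewrite !mxE; exact: Ck_entry.
Qed.

Lemma Ck_right_pinv m n s (M : E -> 'M[R]_(m, n)) :
  (forall z, A z -> M z *m (M z)^T \in unitmx) -> Ck s A M ->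
  Ck s A (fun z => right_pinv (M z)).
Proof.
move=> Mu MC; have MtC := Ck_trmx MC.
by apply: Ck_mulmx => //; apply: Ck_invmx => //; exact: Ck_mulmx.
Qed.

End CkTheory.

(** * Comparison of the maximum norm with the Euclidean and operator norms *)

Section MatrixNorms.
Variable R : realType.

Lemma mx_norm_leP m n (M : 'M[R]_(m, n)) (c : R) :
  0 <= c -> (forall i j, `|M i j| <= c) -> `|M| <= c.
Proof.
move=> c0 Mc; rewrite -[leLHS]/(mx_norm M) mx_normrE.
by apply/bigmax_leP; split.
Qed.

Lemma mx_norm_ge m n (M : 'M[R]_(m, n)) i j : `|M i j| <= `|M|.
Proof.
rewrite -[leRHS]/(mx_norm M) mx_normrE.
by apply: (le_trans _ (le_bigmax _ _ (i, j))).
Qed.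

Lemma mx_norm_mulmx m n k (M : 'M[R]_(m, n)) (N : 'M[R]_(n, k)) :
  `|M *m N| <= n%:R * `|M| * `|N|.
Proof.
apply: mx_norm_leP => [|i j]; first by rewrite !mulr_ge0.
rewrite mxE (le_trans (ler_norm_sum _ _ _))//.
rewrite (@le_trans _ _ (\sum_(l < n) `|M| * `|N|))//.
  by apply: ler_sum => l _; rewrite normrM ler_pM// mx_norm_ge.
by rewrite sumr_const card_ord -mulrA mulr_natl.
Qed.

Lemma enorm0 n : @enorm R n 0 = 0.
Proof. by rewrite /enorm big1 ?sqrtr0// => i _; rewrite mxE expr0n. Qed.

Lemma enorm_ge n (v : 'cV[R]_n) : `|v| <= enorm v.
Proof.
apply: mx_norm_leP => [|i j]; first exact: sqrtr_ge0.
rewrite ord1 -sqrtr_sqr ler_wsqrtr// (bigD1 i)//= lerDl.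
by apply: sumr_ge0 => l _; exact: sqr_ge0.
Qed.

(** The crude factor [n.+1] is positive even for [n = 0], as [bigO_mesh_le] asks of its constant. *)
Lemma enorm_le n (v : 'cV[R]_n) : enorm v <= n.+1%:R * `|v|.
Proof.
have c0 : 0 <= n.+1%:R * `|v| by rewrite mulr_ge0.
rewrite -[leRHS]ger0_norm// -sqrtr_sqr ler_wsqrtr//.
rewrite (@le_trans _ _ (\sum_(i < n) `|v| ^+ 2))//.
  apply: ler_sum => i _; rewrite -[leLHS]real_normK ?num_real//.
  by rewrite lerXn2r ?nnegrE// mx_norm_ge.
rewrite sumr_const card_ord -[leLHS]mulr_natl exprMn ler_wpM2r ?sqr_ge0//.
by rewrite -natrX ler_nat expnS expn1 (leq_trans (leqnSn n))// leq_pmulr.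
Qed.

(** Each entry [M i j] is a coordinate of [M] applied to the unit vector [delta_mx j 0]. *)
Lemma opnorm_ge m n (M : 'M[R]_(m, n)) : `|M| <= opnorm M.
Proof.
(* [sup] dominates the elements of its set only once the set is known to be bounded above. *)
have ub : has_ubound [set enorm (M *m v) | v in [set v | enorm v <= 1]].
  exists (m.+1%:R * (n%:R * `|M| * 1)) => _ [v v1 <-].
  rewrite (le_trans (enorm_le _))// ler_pM2l//.
  rewrite (le_trans (mx_norm_mulmx _ _))// ler_wpM2l ?mulr_ge0//.
  exact: le_trans (enorm_ge v) v1.
apply: mx_norm_leP => [|i j].
  by apply: ub_le_sup => //; exists 0; rewrite /= ?mulmx0 enorm0.
apply: (@le_trans _ _ (enorm (M *m delta_mx j 0))).
  apply: le_trans (enorm_ge _); rewrite -colE.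
  by have := mx_norm_ge (col j M) i 0; rewrite mxE.
apply: ub_le_sup => //; exists (delta_mx j 0) => //=.
rewrite /enorm (bigD1 j)//= big1 ?addr0 => [|l lj].
  by rewrite mxE !eqxx expr1n sqrtr1.
by rewrite mxE (negPf lj) expr0n.
Qed.

End MatrixNorms.

(** * Estimates in powers of the mesh size *)

Lemma mesh_ge0 (R : realType) (I : set R) t0 t : time_grid I t0 t -> 0 <= mesh t.
Proof.
move=> [_ tlt _ ub]; apply: (@le_trans _ _ (t 1%N - t 0%N)).
  by rewrite subr_ge0 ltW.
by apply: ub_le_sup => //; exists 0%N.
Qed.

Lemma continuous_near_bounded (R : realType) (W W' : normedModType R)
    (G : W -> W') w :
  {for w, continuous G} -> exists C, \forall w' \near w, `|G w'| <= C.
Proof.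
move=> Gc; exists (`|G w| + 1).
have /cvgrPdist_lt/(_ _ ltr01) := Gc; apply: filterS => w' ww'.
rewrite -[G w'](subrK (G w)) (le_trans (ler_normD _ _))// addrC lerD2l ltW//.
by rewrite distrC.
Qed.

Section MeshAsymptotics.
Variables (R : realType) (r : nat) (I : set R) (T : set (nat -> R)).
Hypothesis T_mesh : forall t, T t -> 0 <= mesh t.

Local Notation bigO q e := (bigO_mesh r q I T (fun w => `|w|) e).

(** The two norms may differ, so this also passes between the Euclidean, operator and maximum
    norms. *)
Lemma bigO_mesh_le (W W' : Type) q (N : W -> R) (N' : W' -> R) e e' (c : R) :
  0 < c ->
  (forall t k, T t -> (r <= k.+1)%N -> I (t k) -> N' (e' t k) <= c * N (e t k)) ->
  bigO_mesh r q I T N e -> bigO_mesh r q I T N' e'.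
Proof.
move=> c0 e'e eO K cK KI; have [C [tau [C0 tau0 eC]]] := eO K cK KI.
exists (c * C), tau; split=> // [|t Tt ttau k rk Ktk]; first exact: mulr_gt0.
apply: le_trans (e'e t k Tt rk (KI _ Ktk)) _.
by rewrite -mulrA ler_pM2l//; exact: eC.
Qed.

Lemma bigO_mesh_ext (W : Type) q (N : W -> R) e e' :
  (forall t k, T t -> (r <= k.+1)%N -> I (t k) -> e' t k = e t k) ->
  bigO_mesh r q I T N e -> bigO_mesh r q I T N e'.
Proof.
by move=> ee'; apply: (bigO_mesh_le ltr01) => t k Tt rk Ik; rewrite ee'// mul1r.
Qed.

Lemma bigO_meshD (W : normedModType R) q (e e' : (nat -> R) -> nat -> W) :
  bigO q e -> bigO q e' -> bigO q (fun t k => e t k + e' t k).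
Proof.
move=> eO eO' K cK KI; have [C [tau [C0 tau0 eC]]] := eO K cK KI.
have [C' [tau' [C0' tau0' eC']]] := eO' K cK KI.
exists (C + C'), (Num.min tau tau'); split=> [||t Tt].
- exact: addr_gt0.
- by rewrite lt_min tau0 tau0'.
rewrite le_min => /andP[ttau ttau'] k rk Ktk.
by rewrite (le_trans (ler_normD _ _))// mulrDl lerD// ?eC ?eC'.
Qed.

Lemma bigO_meshN (W : normedModType R) q (e : (nat -> R) -> nat -> W) :
  bigO q e -> bigO q (fun t k => - e t k).
Proof.
by apply: (bigO_mesh_le ltr01) => t k _ _ _; rewrite normrN mul1r.
Qed.

(** Order 0 means boundedness for small mesh, so a bounded factor preserves the order of the other
    one. *)
Lemma bigO_mesh_mulmx m n l q q' (e : (nat -> R) -> nat -> 'M[R]_(m, n))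
    (e' : (nat -> R) -> nat -> 'M[R]_(n, l)) :
  bigO q e -> bigO q' e' -> bigO (q + q')%N (fun t k => e t k *m e' t k).
Proof.
move=> eO eO' K cK KI; have [C [tau [C0 tau0 eC]]] := eO K cK KI.
have [C' [tau' [C0' tau0' eC']]] := eO' K cK KI.
exists (n.+1%:R * C * C'), (Num.min tau tau'); split=> [||t Tt].
- by rewrite !mulr_gt0.
- by rewrite lt_min tau0 tau0'.
rewrite le_min => /andP[ttau ttau'] k rk Ktk.
rewrite (le_trans (mx_norm_mulmx _ _))// exprD.
rewrite -[n%:R * _ * _]mulrA -2![leRHS]mulrA ler_pM// ?mulr_ge0//.
  by rewrite ler_nat.
by rewrite mulrA -mulrACA ler_pM// ?eC ?eC'.
Qed.

(** The local bounds of [G] around the points [lam s] become uniform on a compact [K], and [e t k]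
    enters the uniform neighbourhood of [lam (t k)] once the mesh is small. *)
Lemma bigO_mesh_comp (W W' : normedModType R) q (lam : R -> W) (G : W -> W') e :
  (0 < q)%N ->
  (forall s, I s -> {for s, continuous lam}) ->
  (forall s, I s -> exists M, \forall w \near lam s, `|G w| <= M) ->
  bigO q (fun t k => lam (t k) - e t k) -> bigO 0 (fun t k => G (e t k)).
Proof.
move=> q0 lamc Gb eO K cK KI; have [C [tau [C0 tau0 eC]]] := eO K cK KI.
(* A single [d] is both the radius and the inverse of the bound. Shrinking it weakens the claim, so
   compactness yields one [d] for all of [K]. *)
have cov : \forall d \near 0^'+,
    K `<=` (fun s => forall w, `|lam s - w| < d -> `|G w| <= d^-1).
  apply: (iffLR (compact_near_coveringP K) cK _ 0^'+
    (fun d s => forall w, `|lam s - w| < d -> `|G w| <= d^-1)) => s Ks.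
  have [M /nbhs_ballP[e0 /= e0_gt0 GM]] := Gb s (KI _ Ks).
  have e2 : 0 < e0 / 2 by rewrite divr_gt0.
  have M1 : 0 < (`|M| + 1)^-1 by rewrite invr_gt0 ltr_wpDl.
  (* Half of [e0] pays for moving the centre from [lam s] to [lam s'], the other half for the radius
     [d]; the second bound on [d] makes [d^-1] exceed [M]. *)
  exists ([set s' | `|lam s - lam s'| < e0 / 2],
          [set d | 0 < d /\ d < Num.min (e0 / 2) (`|M| + 1)^-1]); first split => /=.
  - by have /cvgrPdist_lt/(_ _ e2) := lamc s (KI _ Ks).
  - by near=> d; split; near: d; [exact: nbhs_right_gt|apply: nbhs_right_lt;
      rewrite lt_min e2 M1].
  move=> [s' d] /= [ss' [d0]]; rewrite lt_min => /andP[de dM] w s'w.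
  apply: (@le_trans _ _ M); last first.
    rewrite (le_trans (ler_norm M))// (@le_trans _ _ (`|M| + 1)) ?lerDl//.
    by rewrite -[leLHS]invrK lef_pV2 ?posrE// ltW.
  apply: GM; rewrite -ball_normE /=.
  rewrite -[lam s - w](subrKA (lam s')) (le_lt_trans (ler_normD _ _))//.
  by rewrite [ltRHS]splitr ltrD// (lt_trans s'w).
have [d [d0 dK]] : exists d : R, 0 < d /\
    K `<=` (fun s => forall w, `|lam s - w| < d -> `|G w| <= d^-1).
  near ((0:R)^'+) => d; exists d; split; first by near: d; exact: nbhs_right_gt.
  by near: d.
(* A mesh at most 1 gives [mesh t ^+ q <= mesh t] as [0 < q], and then [d / (2 * C)] keeps the error
   at most [d / 2]. *)
exists d^-1, (Num.min tau (Num.min 1 (d / (2 * C)))); split=> [||t Tt].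
- by rewrite invr_gt0.
- by rewrite !lt_min tau0 ltr01 divr_gt0// mulr_gt0.
rewrite !le_min => /and3P[ttau t1 td] k rk Ktk.
rewrite expr0 mulr1; apply: (dK _ Ktk); apply: le_lt_trans (eC t Tt ttau k rk Ktk) _.
apply: (@le_lt_trans _ _ (C * mesh t)).
  by rewrite ler_pM2l// -[leRHS]expr1 ler_wiXn2l// T_mesh.
apply: (@le_lt_trans _ _ (C * (d / (2 * C)))); first by rewrite ler_pM2l.
rewrite invfM [2^-1 * _]mulrC mulrCA mulVKf ?gt_eqF//.
by rewrite ltr_pdivrMr// ltr_pMr// ltr1n.
Unshelve. all: by end_near. Qed.

Lemma bigO_mesh_locally_bounded (W : normedModType R) (e : (nat -> R) -> nat -> W)
    q (lam : R -> W) :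
  (0 < q)%N -> (forall s, I s -> {for s, continuous lam}) ->
  bigO q (fun t k => lam (t k) - e t k) -> bigO 0 e.
Proof.
move=> q0 lamc; apply: (@bigO_mesh_comp _ _ _ lam id) => // s Is.
exact: (continuous_near_bounded (G := id) (@cvg_id _ _)).
Qed.

Lemma bigO_mesh_continuous (W : normedModType R) (lam : R -> W) :
  (forall s, I s -> {for s, continuous lam}) -> bigO 0 (fun t k => lam (t k)).
Proof.
(* [lam] is compared with itself: the error is 0, and 1 is just some positive order. *)
move=> lamc; apply: (@bigO_mesh_locally_bounded _ _ 1%N lam) => //.
move=> K _ _; exists 1, 1; split=> // t Tt _ k _ _.
by rewrite subrr normr0 mul1r expr1 T_mesh.
Qed.

End MeshAsymptotics.

(** * Right pseudoinverse and the exact residual identity *)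

Section RightPseudoinverse.
Variables (R : realType) (m n : nat).
Implicit Type M : 'M[R]_(m, n).

(** If [v] kills the Gram matrix, then [(v *m M) *m (v *m M)^T], a sum of squares, is 0; hence
    [v *m M = 0], and [v = 0] by full row rank. *)
Lemma row_free_gram_unit M : row_free M -> M *m M^T \in unitmx.
Proof.
move=> Mfree; rewrite -row_free_unit; apply: inj_row_free => v vMM0.
have vM0 : v *m M = 0.
  have vv0 : (v *m M) *m (v *m M)^T = 0.
    by rewrite trmx_mul mulmxA -[v *m M *m _]mulmxA vMM0 mul0mx.
  move: (v *m M) vv0 => w ww0; apply/rowP => j.
  have /eqP := congr1 (fun N : 'M[R]_1 => N 0 0) ww0; rewrite !mxE.
  rewrite psumr_eq0 => [/allP/(_ j)|i _]; last by rewrite mxE -expr2 sqr_ge0.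
  by rewrite mem_index_enum mxE -expr2 sqrf_eq0 => /(_ isT)/eqP.
by apply/eqP; rewrite -(mulmx_free_eq0 _ Mfree) vM0.
Qed.

Lemma right_pinvK M : M *m M^T \in unitmx -> M *m right_pinv M = 1%:M.
Proof. by move=> Mu; rewrite /right_pinv mulmxA mulmxV. Qed.

(** Order 0 case of [Ck_right_pinv] for the identity map, on the set where the Gram determinant is
    nonzero; this set is open because the determinant is continuous. *)
Lemma right_pinv_continuous M :
  M *m M^T \in unitmx -> {for M, continuous (@right_pinv R m n)}.
Proof.
have idC A : Ck 0 A (fun N : 'M[R]_(m, n) => N) by move=> N _; exact: cvg_id.
have gramo : open [set N : 'M[R]_(m, n) | N *m N^T \in unitmx].
  have detc : continuous (fun N : 'M[R]_(m, n) => \det (N *m N^T)).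
    move=> N; apply: (@Ck_det _ _ setT openT _ 0 _ _ N I) => i j.
    exact/(Ck_entry openT)/(Ck_mulmx openT (idC _))/(Ck_trmx openT).
  rewrite (_ : mkset _ = (fun N => \det (N *m N^T)) @^-1` [set x | x != 0]).
    by move/continuousP : detc; apply; exact: open_neq.
  by apply/funext => N /=; rewrite unitmxE unitfE.
by move=> Mu; exact: (Ck_right_pinv gramo (fun _ => id) (idC _)).
Qed.

End RightPseudoinverse.

(** [Lambdatau] cancels its right inverse, so applying it to the correction returns the whole
    residual of [ftau]. *)
Lemma f_MN_residual (R : realType) (n m c : nat) (ftau : discrete R n c 'cV[R]_n)
    (Lambdatau : discrete R n c 'M[R]_(m, n)) (dpsi : discrete R n c 'cV[R]_m) t z :
  Lambdatau t z *m (Lambdatau t z)^T \in unitmx ->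
  Lambdatau t z *m f_MN ftau Lambdatau dpsi t z + dpsi t z = 0.
Proof.
move=> Lu; rewrite /f_MN mulmxBr mulmxA right_pinvK// mul1mx.
by rewrite opprD addNKr addNr.
Qed.

(** * Openness of the stencil and jet domains *)

Section OpenDomains.
Variables (R : realType) (n : nat) (I : set R) (U : set 'cV[R]_n).
Hypotheses (I_open : open I) (U_open : open U).

Lemma near_col (c : nat) (P : set 'cV[R]_n) (j : 'I_c) (z : R * 'M[R]_(n, c)) :
  open P -> P (col j z.2) -> \forall z' \near z, P (col j z'.2).
Proof.
move=> Po Pz.
have colc : {for z, continuous (fun z' : R * 'M[R]_(n, c) => col j z'.2)}.
  apply: (@Ck_mx _ _ setT openT _ _ 0 _ _ z Logic.I) => i k.
  under eq_fun do rewrite mxE.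
  apply: (@Ck_entry _ _ _ openT _ _ 0 (fun z' : R * 'M[R]_(n, c) => z'.2)) => y _.
  exact: cvg_snd.
by apply: colc; exact: open_nbhs_nbhs.
Qed.

Lemma near_time (V : normedModType R) (z : R * V) :
  I z.1 -> \forall z' \near z, I z'.1.
Proof. by move=> Iz; apply: cvg_fst; exact: open_nbhs_nbhs. Qed.

Lemma open_stencil_domain c : open (@stencil_domain R n c I U).
Proof.
rewrite openE => z [Iz Uz]; near=> z'; split; near: z'; first exact: near_time.
by apply: filter_forall => j; exact: near_col.
Unshelve. all: by end_near. Qed.

Lemma open_jet_domain p (V : nat -> set 'cV[R]_n) :
  (forall j, open (V j)) -> open (@jet_domain R n p I U V).
Proof.
move=> Vo; rewrite openE => z [Iz Uz Vz].
near=> z'; split; near: z'; [exact: near_time|exact: near_col|].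
apply: filter_forall => j; have [j0|j0] := boolP (0 < j)%N.
  by apply: filterS (near_col (Vo j) (Vz j j0)) => z' + _.
by apply: nearW => z' j0'; case/negP: j0.
Unshelve. all: by end_near. Qed.

End OpenDomains.

(** * Jets and stencils of a curve *)

Section Curves.
Variables (R : realType) (n p s : nat) (I : set R) (U : set 'cV[R]_n).
Variables (V : nat -> set 'cV[R]_n) (x : R -> 'cV[R]_n).
Hypothesis xV : curve p s I U V x.

Lemma col_jet0 u : col ord0 (jet p x u) = x u.
Proof. by apply/colP => i; rewrite !mxE. Qed.

(** For [p = 0] the index [inord 1] would fall back to column 0, which holds [x] itself. *)
Lemma xdot_jet u : (0 < p)%N -> xdot (u, jet p x u) = derive1 x u.
Proof. by move=> p0; apply/colP => i; rewrite !mxE inordK. Qed.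

Lemma curve_states u : I u -> U (x u).
Proof. by move=> Iu; have [_ /(_ u Iu)[_ /= +]] := xV; rewrite col_jet0. Qed.

Lemma curve_C1 : (0 < s)%N -> C1curve I U x.
Proof.
move=> s0; split; last exact: curve_states.
by have [xC _] := xV; exact: Ck_le xC.
Qed.

Lemma stencil_in_domain r t0 t k :
  time_grid I t0 t -> stencil_domain I U (t k, stencil r x t k).
Proof.
move=> [_ _ It _]; split=> //= j.
(* A truncated index points to [t 0], which lies in [I] like every grid point. *)
rewrite (_ : col j _ = x (t (k.+1 - j)%N)); first exact/curve_states/It.
by apply/colP => i; rewrite !mxE.
Qed.

End Curves.

(** * Chain rule along curves *)

Section ChainRule.
Variables (R : realType) (n : nat) (W : normedModType R).

Lemma continuous_along (g : R * 'cV[R]_n -> W) (x : R -> 'cV[R]_n) s :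
  {for (s, x s), continuous g} -> {for s, continuous x} ->
  {for s, continuous (fun u => g (u, x u))}.
Proof.
move=> gc xc; apply: (@continuous_comp _ _ _ (fun u => (u, x u)) g) => //.
by apply: (@cvg_pair _ _ _ (nbhs s) (nbhs s) (nbhs (x s)) _ _ _ id x).
Qed.

Lemma derive1_along (g : R * 'cV[R]_n -> W) (x : R -> 'cV[R]_n) s :
  differentiable g (s, x s) -> differentiable x s ->
  derive1 (fun u => g (u, x u)) s = 'd g (s, x s) (1, derive1 x s).
Proof.
move=> dg dx.
have dc : is_diff s (fun u => (u, x u)) (fun h => (h, 'd x s h)).
  exact: is_diff_pair (is_diff_id s) (differentiableP dx).
have dgx := is_diff_comp dc (differentiableP dg).
have dgx' : differentiable (fun u => g (u, x u)) s := @ex_diff _ _ _ _ _ _ _ dgx.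
rewrite derive1E'// (derive1E' dx).
exact: (congr1 (@^~ 1) (@diff_val _ _ _ _ _ _ _ dgx)).
Qed.

Lemma continuous_derive1 (I : set R) (x : R -> W) s :
  open I -> Ck 1 I x -> I s -> {for s, continuous (derive1 x)}.
Proof.
move=> Io [dx dxc] Is; apply: (Ck_ext (s := 0) Io _ (dxc 1)) => // u Iu.
by rewrite derive1E'//; exact: dx.
Qed.

End ChainRule.

(** * Pointwise identities for the multiplier *)

Section MultiplierIdentities.
Variables (R : realType) (n m : nat) (I : set R) (U : set 'cV[R]_n).
Variables (f : R * 'cV[R]_n -> 'cV[R]_n) (psi : R * 'cV[R]_n -> 'cV[R]_m).
Variable (Lambda : R * 'cV[R]_n -> 'M[R]_(m, n)).
Hypotheses (I_open : open I) (psi_C1 : Ck 1 (I `*` U) psi).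
Hypothesis (Lambda_mult : multiplier I U f psi Lambda).

(* Test the multiplier identity on the constant curve through y. *)
Lemma multiplier_source s y : I s -> U y ->
  Lambda (s, y) *m f (s, y) + 'd psi (s, y) (1, 0) = 0.
Proof.
move=> Is Uy.
have yC : C1curve I U (fun=> y) by split=> [|? _] //; exact: Ck_cst.
have [_ /(_ _ yC s Is)] := Lambda_mult.
rewrite derive1_along; [|exact: psi_C1.1|exact: differentiable_cst].
by rewrite derive1_cst sub0r mulmxN => <-; rewrite subrr.
Qed.

(** Substituting [Lambda (x' - f)] for the total derivative of [psi] cancels [Lambda x'] and leaves
    [multiplier_source]. *)
Lemma multiplier_velocity x s : C1curve I U x -> I s ->
  Lambda (s, x s) *m derive1 x s - 'd psi (s, x s) (1, derive1 x s) +
    'd psi (s, x s) (1, 0) = 0.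
Proof.
move=> xC Is; have [[dx _] xU] := xC; have [_ /(_ x xC s Is)] := Lambda_mult.
have Us := xU s Is.
rewrite derive1_along; [|by apply: psi_C1.1|exact: dx].
move=> <-; rewrite mulmxBr opprB [X in X + _]addrC subrK.
exact: multiplier_source.
Qed.

End MultiplierIdentities.

(** * Conservation and orders of consistency of the MN method *)

Theorem theorem3p4 (R : realType) (m n p q r : nat)
    (hm : (1 <= m)%N) (hn : (1 <= n)%N) (hp : (1 <= p)%N) (hq : (1 <= q)%N)
    (hr : (1 <= r)%N)
    (* time interval, state space, ranges of the derivatives *)
    (I : set R) (U : set 'cV[R]_n) (V : nat -> set 'cV[R]_n)
    (I_open : open I) (I_itv : is_interval I)
    (U_open : open U) (V_open : forall j, open (V j))
    (* dynamical system *)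
    (f : R * 'cV[R]_n -> 'cV[R]_n)
    (f_Ck : Ck p.-1 (I `*` U) f)
    (f_lip : exists L : R, forall s, I s -> L.-lipschitz_U (fun y => f (s, y)))
    (t0 : R) (x0 : 'cV[R]_n) (It0 : I t0) (Ux0 : U x0)
    (ivp : exists2 x, is_solution I U f x & x t0 = x0)
    (* conserved quantity and conservation law multiplier *)
    (psi : R * 'cV[R]_n -> 'cV[R]_m)
    (Lambda : R * 'cV[R]_n -> 'M[R]_(m, n))
    (psi_conserved : conserved_quantity I U f psi)
    (Lambda_mult : multiplier I U f psi Lambda)
    (lt_mn : (m < n)%N)
    (Lambda_rank : forall z, (I `*` U) z -> row_free (Lambda z))
    (* time grids and discrete functions *)
    (T : set (nat -> R)) (T_grid : forall t, T t -> time_grid I t0 t)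
    (ftau Dx : discrete R n r.+1 'cV[R]_n)
    (Dpsi dpsi : discrete R n r.+1 'cV[R]_m)
    (Lambdatau : discrete R n r.+1 'M[R]_(m, n))
    (psitau : discrete R n r 'cV[R]_m)
    (ftau_cons : consistent q (p + q) I U V T (@enorm R n)
      (of_state (p := p) f) ftau)
    (Dx_cons : consistent q (p + q) I U V T (@enorm R n)
      (@xdot R n p) Dx)
    (Dpsi_cons : consistent q (p + q) I U V T (@enorm R m)
      (total_t (p := p) psi) Dpsi)
    (dpsi_cons : consistent q (p + q) I U V T (@enorm R m)
      (partial_t (p := p) psi) dpsi)
    (Lambdatau_cons : consistent q (p + q) I U V T (@opnorm R m n)
      (of_state (p := p) Lambda) Lambdatau)
    (psitau_cons : exists2 q' : nat, (1 <= q')%N &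
      consistent q' (p + q) I U V T (@enorm R m)
        (of_state (p := p) psi) (delay psitau))
    (Dpsi_compat : constant_compatible U T Dpsi psitau)
    (* the inverse in the pseudoinverse of Lambdatau exists *)
    (Lambdatau_inv : forall t z, T t -> stencil_domain I U z ->
      Lambdatau t z *m (Lambdatau t z)^T \in unitmx)
    (compat : forall t k (X : 'M[R]_(n, r.+1)), T t -> (r <= k.+1)%N ->
      (forall j, U (col j X)) ->
      F_MN Dx ftau Lambdatau dpsi t (t k, X) = 0 ->
      Lambdatau t (t k, X) *m Dx t (t k, X) =
        Dpsi t (t k, X) - dpsi t (t k, X)) :
  [/\ conservative U T (F_MN Dx ftau Lambdatau dpsi) psitau,
      consistent q (p + q) I U V T (@enorm R n)
        (ode (p := p) f) (F_MN Dx ftau Lambdatau dpsi),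
      forall x, curve p (p + q) I U V x ->
        bigO_mesh r q I T (@enorm R m) (fun t k =>
          let z := (t k, stencil r x t k) in
          Lambdatau t z *m Dx t z - Dpsi t z + dpsi t z) &
      forall x, curve p (p + q) I U V x ->
        bigO_mesh r q I T (@enorm R m) (fun t k =>
          let z := (t k, stencil r x t k) in
          Lambdatau t z *m f_MN ftau Lambdatau dpsi t z + dpsi t z)].
Proof.
have T_mesh t : T t -> 0 <= mesh t by move/T_grid; exact: mesh_ge0.
have stencil_open : open (@stencil_domain R n r.+1 I U).
  exact: open_stencil_domain.
have pq0 : (0 < p + q)%N by rewrite ltn_addr.
have psi_C1 : Ck 1 (I `*` U) psi by case: psi_conserved.
have state_domain t k (X : 'M[R]_(n, r.+1)) : T t -> (forall j, U (col j X)) ->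
    stencil_domain I U (t k, X).
  by move=> /T_grid[_ _ It _] UX; split=> //=.
have enormO k l (e e' : (nat -> R) -> nat -> 'cV[R]_k) :
    (forall t j, T t -> (r <= j.+1)%N -> I (t j) -> e' t j = e t j) ->
    bigO_mesh r l I T (fun w => `|w|) e -> bigO_mesh r l I T (@enorm R k) e'.
  move=> ee'; apply: (@bigO_mesh_le _ _ _ _ _ _ _ _ _ _ _ k.+1%:R) => // t j Tt rj Ij.
  by rewrite ee'//; exact: enorm_le.
have [f_jet ftau_C ftau_O] := ftau_cons.
have [xdot_C Dx_C Dx_O] := Dx_cons.
have [_ _ Dpsi_O] := Dpsi_cons.
have [_ dpsi_C dpsi_O] := dpsi_cons.
have [_ Lambdatau_C Lambdatau_O] := Lambdatau_cons.
pose at_curve x t k : R * 'M[R]_(n, r.+1) := (t k, stencil r x t k).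
(* The consistency hypotheses are restated in the maximum norm, with the jet replaced by [x] and its
   derivative. *)
have norm_Lambda x : curve p (p + q) I U V x -> bigO_mesh r q I T (fun w => `|w|)
    (fun t k => Lambda (t k, x (t k)) - Lambdatau t (at_curve x t k)).
  move=> xV; apply: (bigO_mesh_le ltr01 _ (Lambdatau_O x xV)) => t k _ _ _.
  by rewrite mul1r /of_state /= col_jet0; exact: opnorm_ge.
have norm_f x : curve p (p + q) I U V x -> bigO_mesh r q I T (fun w => `|w|)
    (fun t k => f (t k, x (t k)) - ftau t (at_curve x t k)).
  move=> xV; apply: (bigO_mesh_le ltr01 _ (ftau_O x xV)) => t k _ _ _.
  by rewrite mul1r /of_state /= col_jet0; exact: enorm_ge.
have norm_Dx x : curve p (p + q) I U V x -> bigO_mesh r q I T (fun w => `|w|)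
    (fun t k => derive1 x (t k) - Dx t (at_curve x t k)).
  move=> xV; apply: (bigO_mesh_le ltr01 _ (Dx_O x xV)) => t k _ _ _.
  by rewrite mul1r xdot_jet//; exact: enorm_ge.
have norm_dpsi x : curve p (p + q) I U V x -> bigO_mesh r q I T (fun w => `|w|)
    (fun t k => 'd psi (t k, x (t k)) (1, 0) - dpsi t (at_curve x t k)).
  move=> xV; apply: (bigO_mesh_le ltr01 _ (dpsi_O x xV)) => t k _ _ _.
  by rewrite mul1r /partial_t /= col_jet0; exact: enorm_ge.
have norm_Dpsi x : curve p (p + q) I U V x -> bigO_mesh r q I T (fun w => `|w|)
    (fun t k => 'd psi (t k, x (t k)) (1, derive1 x (t k)) -
                Dpsi t (at_curve x t k)).
  move=> xV; apply: (bigO_mesh_le ltr01 _ (Dpsi_O x xV)) => t k _ _ _.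
  by rewrite mul1r /total_t xdot_jet//= col_jet0; exact: enorm_ge.
have x_cont x s : curve p (p + q) I U V x -> I s -> {for s, continuous x}.
  by move=> xV Is; have [[dx _] _] := curve_C1 xV pq0; exact/differentiable_continuous/dx.
have Lambda_cont x s : curve p (p + q) I U V x -> I s ->
    {for s, continuous (fun u => Lambda (u, x u))}.
  move=> xV Is; apply: continuous_along (x_cont _ _ xV Is).
  by apply: Lambda_mult.1; split=> //; exact: curve_states xV _ Is.
have f_cont x s : curve p (p + q) I U V x -> I s ->
    {for s, continuous (fun u => f (u, x u))}.
  move=> xV Is; apply: continuous_along (x_cont _ _ xV Is).
  by apply: (Ck_le (leq0n _) f_Ck); split=> //; exact: curve_states xV _ Is.
have dx_cont x s : curve p (p + q) I U V x -> I s -> {for s, continuous (derive1 x)}.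
  by move=> xV; apply: continuous_derive1 => //; case: (curve_C1 xV pq0).
have residual_O x : curve p (p + q) I U V x -> bigO_mesh r q I T (fun w => `|w|)
    (fun t k => Lambdatau t (at_curve x t k) *m ftau t (at_curve x t k) +
                dpsi t (at_curve x t k)).
  move=> xV; have ftau_bounded := bigO_mesh_locally_bounded (lam := fun s => f (s, x s))
    T_mesh hq (fun s => @f_cont x s xV) (norm_f x xV).
  have := bigO_mesh_mulmx (norm_Lambda x xV) ftau_bounded; rewrite addn0 => LO.
  have fO := bigO_mesh_mulmx
    (bigO_mesh_continuous r T_mesh (fun s => @Lambda_cont x s xV)) (norm_f x xV).
  (* As [Lambda f + psi_t = 0], the residual is [- (Lambda - Lambdatau) ftau - Lambda (f - ftau) -
     (psi_t - dpsi)]. *)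
  apply: bigO_mesh_ext (bigO_meshD (bigO_meshD (bigO_meshN LO) (bigO_meshN fO))
    (bigO_meshN (norm_dpsi x xV))) => t k Tt _ Itk.
  have := multiplier_source I_open psi_C1 Lambda_mult Itk (curve_states xV Itk).
  move/eqP; rewrite addrC addr_eq0 => /eqP ->.
  by rewrite mulmxBl mulmxBr !opprB opprK subrKA [dpsi _ _ + _]addrC subrKA.
have pinv_O x : curve p (p + q) I U V x -> bigO_mesh r 0 I T (fun w => `|w|)
    (fun t k => right_pinv (Lambdatau t (at_curve x t k))).
  move=> xV; apply: (bigO_mesh_comp (lam := fun s => Lambda (s, x s))
    (G := @right_pinv R m n) T_mesh hq _ _ (norm_Lambda x xV)) => s Is.
    exact: Lambda_cont.
  apply/continuous_near_bounded/right_pinv_continuous/row_free_gram_unit.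
  by apply: Lambda_rank; split=> //; exact: curve_states xV _ Is.
split.
- move=> t k X Tt rk UX F0; apply: Dpsi_compat => //.
  have Lu := Lambdatau_inv _ _ Tt (state_domain _ k _ Tt UX).
  have DxE : Dx t (t k, X) = f_MN ftau Lambdatau dpsi t (t k, X).
    by apply/eqP; rewrite -subr_eq0; apply/eqP.
  (* The condition now reads [Lambdatau f_MN = Dpsi - dpsi], and the residual identity leaves
     [Dpsi = 0]. *)
  have := compat t k X Tt rk UX F0; rewrite DxE => /eqP.
  by rewrite eq_sym subr_eq f_MN_residual// => /eqP.
- split.
  + exact: (CkB (open_jet_domain I_open U_open V_open) xdot_C f_jet).
  + move=> t Tt; have [[fC LC] dC] := (ftau_C t Tt, Lambdatau_C t Tt, dpsi_C t Tt).
    have pinvC := Ck_right_pinv stencil_open (fun z => @Lambdatau_inv t z Tt) LC.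
    have resC := CkD stencil_open (Ck_mulmx stencil_open LC fC) dC.
    have fMNC := CkB stencil_open fC (Ck_mulmx stencil_open pinvC resC).
    exact: (CkB stencil_open (Dx_C t Tt) fMNC).
  + move=> x xV.
    (* The error splits into [(x' - Dx) - (f - ftau)] minus the bounded pseudoinverse times the
       residual of order [q]. *)
    apply: enormO (bigO_meshD (bigO_meshD (norm_Dx x xV) (bigO_meshN (norm_f x xV)))
      (bigO_meshN (bigO_mesh_mulmx (pinv_O x xV) (residual_O x xV)))) => t k Tt _ Itk.
    rewrite /ode /F_MN /f_MN /of_state xdot_jet//= col_jet0.
    by rewrite !opprB [_ - _ - Dx _ _]addrAC addrA addrACA [in RHS]addrACA [- f _ + _]addrC.
- move=> x xV; have Dx_bounded :=
    bigO_mesh_locally_bounded T_mesh hq (fun s => @dx_cont x s xV) (norm_Dx x xV).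
  have := bigO_mesh_mulmx (norm_Lambda x xV) Dx_bounded; rewrite addn0 => LO.
  have dxO := bigO_mesh_mulmx
    (bigO_mesh_continuous r T_mesh (fun s => @Lambda_cont x s xV)) (norm_Dx x xV).
  (* By [multiplier_velocity] the expression is [- (Lambda - Lambdatau) Dx - Lambda (x' - Dx)] plus
     the error of [Dpsi] minus that of [dpsi]. *)
  apply: enormO (bigO_meshD (bigO_meshD (bigO_meshD (bigO_meshN LO) (bigO_meshN dxO))
    (norm_Dpsi x xV)) (bigO_meshN (norm_dpsi x xV))) => t k Tt _ Itk.
  have := multiplier_velocity I_open psi_C1 Lambda_mult (curve_C1 xV pq0) Itk.
  move/eqP; rewrite addrC addr_eq0 opprB => /eqP ->.
  rewrite mulmxBl mulmxBr !opprB subrKA [dpsi _ _ + _]addrC addrA.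
  by congr (_ + _); rewrite [RHS]addrAC !subrKA.
(* On stencils of a curve this quantity is exactly 0, so any positive constants do. *)
- move=> x xV; apply: (@enormO _ _ (fun=> fun=> 0)).
    move=> t k Tt _ Itk /=; apply: f_MN_residual; apply: Lambdatau_inv => //.
    exact: (stencil_in_domain xV r k (T_grid _ Tt)).
  move=> K _ _; exists 1, 1; split=> // t Tt _ k _ _.
  by rewrite normr0 mul1r exprn_ge0// T_mesh.
Qed.
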